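(* There is an absolute constant $C>0$ such that the following holds. Let $\mathbb{F}_q$ be a finite field of odd characteristic, and for each positive integer $n$ let $A\in\mathbb{F}_q^{n\times n}$ be a uniformly random $n\times n$ matrix over $\mathbb{F}_q$. Then: (i) $\Pr[\operatorname{per}(A)=0]\ge \frac{1}{q}$ for all $n$; (ii) $\limsup_{n\to\infty}\Pr[\operatorname{per}(A)=0]<\alpha_q$ (strict inequality), where $\alpha_q=1-\prod_{i=1}^{\infty}(1-q^{-i})$; (iii) for all $n\ge 3$, $\Pr[\operatorname{per}(A)=0]\le \frac{1}{q}+\frac{C}{q^3}$.
   Context: For an $n\times n$ matrix $A=(a_{i,j})$, the permanent is $\operatorname{per}(A)=\sum_{\pi\in S_n}\prod_{i=1}^n a_{i,\pi(i)}$. For a prime power $q$, $\alpha_q=1-\prod_{i=1}^{\infty}(1-q^{-i})$ (this is the limiting probability that a uniformly random $n\times n$ matrix over $\mathbb{F}_q$ has determinant zero). *)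

(* Defs.v *)
From mathcomp Require Import all_boot all_order all_fingroup all_algebra.
From mathcomp Require Import all_classical all_reals all_analysis.
Set Implicit Arguments.
Unset Strict Implicit.
Unset Printing Implicit Defensive.
Import Order.TTheory GRing.Theory Num.Theory.
Import numFieldNormedType.Exports.
Local Open Scope ring_scope.

Definition permanent (K : comNzRingType) (n : nat) (A : 'M[K]_n) : K :=
  \sum_(s : 'S_n) \prod_(i < n) A i (s i).

Definition unif_prob (R : realType) (T : finType) (E : pred T) : R :=
  #|[pred x | E x]|%:R / #|T|%:R.

Definition prob_per0 (R : realType) (F : finFieldType) (n : nat) : R :=
  @unif_prob R 'M[F]_n (fun A => permanent A == 0).

Definition alpha (R : realType) (q : nat) : R :=
  1 - limn (fun n => \prod_(1 <= i < n.+1) (1 - (q%:R : R) ^- i)).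

(* Main.v *)
(** A k-tuple of rows is [extendable] when some completion to an n x n matrix
    has nonzero permanent, i.e. when the product of the k linear forms is nonzero
    in F[x_1..x_n]/(x_i^2).  The rows killing this product form a subspace of
    dimension at most k, so revealing the rows one at a time gives
    P(per != 0) >= prod_{1<=i<=n} (1 - q^-i), the value for determinants.

    The gain comes from the last row but one.  After n-2 rows, the permanents
    G_ab obtained by completing with two unit rows e_a, e_b form a symmetric
    matrix with zero diagonal whose kernel is the annihilator.  A triangle of
    nonzero entries G_ab, G_ac, G_bc has determinant 2 G_ab G_ac G_bc, so in odd
    characteristic it forces rank at least 3, i.e. an annihilator of dimension at
    most n-3 instead of n-2.  Resampling columns a and b shows that such a
    triangle appears with probability at least
    (1 - 1/q)^2 prod_{1<=i<=n-2} (1 - q^-i). *)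
Require Import Defs.
From mathcomp Require Import all_boot all_order all_fingroup all_algebra.
From mathcomp Require Import all_classical all_reals all_analysis.
From mathcomp Require Import ring lra zify.
Import Order.TTheory GRing.Theory Num.Theory.
Import numFieldNormedType.Exports.
Local Open Scope ring_scope.
Set Implicit Arguments.
Unset Strict Implicit.
Unset Printing Implicit Defensive.

(** * Multilinearity and symmetries of the permanent *)

Section Permanent.
Variables (K : comNzRingType) (n : nat).
Implicit Types (A B : 'M[K]_n) (i j : 'I_n) (u v : 'rV[K]_n).

Definition set_row A i u : 'M[K]_n :=
  \matrix_(a, b) if a == i then u 0 b else A a b.

Definition unit_row j : 'rV[K]_n := delta_mx 0 j.

Lemma set_rowE A i u a b :
  set_row A i u a b = if a == i then u 0 b else A a b.
Proof. by rewrite mxE. Qed.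

Lemma row_set_row_eq A i u : row i (set_row A i u) = u.
Proof. by apply/rowP => b; rewrite !mxE eqxx. Qed.

Lemma row_set_row_neq A i a u : a != i -> row a (set_row A i u) = row a A.
Proof. by move=> ai; apply/rowP => b; rewrite !mxE (negbTE ai). Qed.

Lemma set_row_set_row A i u v : set_row (set_row A i u) i v = set_row A i v.
Proof. by apply/matrixP => a b; rewrite !mxE; case: eqP. Qed.

Lemma set_row_id A i : set_row A i (row i A) = A.
Proof. by apply/matrixP => a b; rewrite !mxE; case: eqP => // ->. Qed.

Lemma set_rowC A i j u v : i != j ->
  set_row (set_row A i u) j v = set_row (set_row A j v) i u.
Proof.
move=> ij; apply/matrixP => a b; rewrite !mxE.
by case: (a =P j) => // ->; rewrite eq_sym (negbTE ij).
Qed.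

Lemma permanent1 : permanent (1%:M : 'M[K]_n) = 1.
Proof.
rewrite /permanent (bigD1 1%g) //= [X in _ + X]big1 ?addr0.
  by rewrite big1 // => i _; rewrite perm1 mxE eqxx.
move=> s s1; have /existsP [i si] : [exists i, s i != i].
  apply: contraNT s1; rewrite negb_exists => /forallP s1.
  by apply/eqP; apply/permP => i; rewrite perm1; apply/eqP/negbNE/s1.
by rewrite (bigD1 i) //= mxE eq_sym (negbTE si) mul0r.
Qed.

Lemma permanent_tr A : permanent A^T = permanent A.
Proof.
rewrite [RHS]/permanent (reindex_inj invg_inj) /=; apply: eq_bigr => s _.
rewrite [RHS](reindex_inj (@perm_inj _ s)) /=; apply: eq_bigr => i _.
by rewrite mxE permK.
Qed.

Lemma permanent_row_perm (s : 'S_n) A : permanent (row_perm s A) = permanent A.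
Proof.
rewrite [RHS]/permanent (reindex_inj (mulgI s^-1)%g) /=; apply: eq_bigr => t _.
rewrite [RHS](reindex_inj (@perm_inj _ s)) /=; apply: eq_bigr => i _.
by rewrite mxE permM permK.
Qed.

Lemma permanent_col_perm (s : 'S_n) A : permanent (col_perm s A) = permanent A.
Proof. by rewrite -permanent_tr tr_col_perm permanent_row_perm permanent_tr. Qed.

Lemma permanent_set_row_swap A i j u v : i != j ->
  permanent (set_row (set_row A i u) j v) = permanent (set_row (set_row A i v) j u).
Proof.
move=> ij; rewrite -(permanent_row_perm (tperm i j)); congr permanent.
apply/matrixP => a b; rewrite !mxE; case: tpermP => [->|->|/eqP/negbTE ai /eqP/negbTE aj].
- by rewrite !eqxx (negbTE ij).
- by rewrite !eqxx (negbTE ij).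
- by rewrite ai aj.
Qed.

Lemma permanent_set_row_is_linear A i a u v :
  permanent (set_row A i (a *: u + v)) =
  a * permanent (set_row A i u) + permanent (set_row A i v).
Proof.
rewrite /permanent big_distrr -big_split; apply: eq_bigr => s _ /=.
rewrite !(bigD1 i (_ : predT i)) //= !set_rowE eqxx !mxE mulrDl mulrA.
by congr (_ * _ + _ * _); apply: eq_bigr => b /negbTE bi; rewrite !set_rowE bi.
Qed.

Lemma permanent_set_row0 A i : permanent (set_row A i 0) = 0.
Proof.
by have := permanent_set_row_is_linear A i (-1) 0 0; rewrite scaler0 addr0 mulN1r addNr.
Qed.

Lemma permanent_set_rowD A i u v :
  permanent (set_row A i (u + v)) =
  permanent (set_row A i u) + permanent (set_row A i v).
Proof. by have := permanent_set_row_is_linear A i 1 u v; rewrite scale1r mul1r. Qed.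

Lemma permanent_set_rowZ A i a u :
  permanent (set_row A i (a *: u)) = a * permanent (set_row A i u).
Proof.
by have := permanent_set_row_is_linear A i a u 0; rewrite permanent_set_row0 !addr0.
Qed.

Lemma permanent_set_row_unit A i :
  permanent A != 0 -> exists j, permanent (set_row A i (unit_row j)) != 0.
Proof.
move=> perA; apply/existsP; apply: contraNT perA.
rewrite negb_exists => /forallP per0; rewrite -(set_row_id A i) [row i A]row_sum_delta.
apply/eqP; elim/big_ind: _ => [|u v Hu Hv|j _].
- exact: permanent_set_row0.
- by rewrite permanent_set_rowD Hu Hv addr0.
- by rewrite permanent_set_rowZ (eqP (negbNE (per0 j))) mulr0.
Qed.

(** No permutation sends two rows to one column; this is the relation [x_j^2 = 0] in terms of
    matrices. *)
Lemma permanent_unit_rows A i1 i2 j : i1 != i2 ->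
  row i1 A = unit_row j -> row i2 A = unit_row j -> permanent A = 0.
Proof.
move=> i12 /rowP r1 /rowP r2; apply: big1 => s _.
rewrite (bigD1 i1) // (bigD1 i2) ?(eq_sym i2) //=.
have := r1 (s i1); have := r2 (s i2); rewrite !mxE /= => -> ->.
case: (s i1 =P j) => [s1|]; last by rewrite mul0r.
case: (s i2 =P j) => [s2|]; last by rewrite mul0r mulr0.
by rewrite (perm_inj (etrans s1 (esym s2))) eqxx in i12.
Qed.

End Permanent.

(** * Annihilators of prescribed rows, with dimensions measured by cardinality *)

Section Annihilator.
Variables (F : finFieldType) (n : nat).
Implicit Types (A B : 'M[F]_n) (i j : 'I_n) (u v w : 'rV[F]_n).
Implicit Types (P Q : pred 'M[F]_n) (S : {set 'I_n}).
Local Notation q := #|F|.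

(** The predicate is arbitrary so that one notion covers prescribed rows ([agree S A]), a finite
    list of matrices, and [pred0], which gives the whole space. *)
Definition ann P i : {set 'rV[F]_n} :=
  [set u | [forall B, P B ==> (permanent (set_row B i u) == 0)]].

Lemma annP P i u :
  reflect (forall B, P B -> permanent (set_row B i u) = 0) (u \in ann P i).
Proof.
rewrite inE; apply: (iffP forallP) => [H B PB|H B].
  by apply/eqP; move: (H B); rewrite PB.
by apply/implyP => PB; rewrite H.
Qed.

Lemma ann_linear P i a u v :
  u \in ann P i -> v \in ann P i -> a *: u + v \in ann P i.
Proof.
move=> /annP Hu /annP Hv; apply/annP => B PB.
by rewrite permanent_set_row_is_linear Hu // Hv // mulr0 addr0.
Qed.

Lemma ann0 P i : 0 \in ann P i.
Proof. by apply/annP => B _; rewrite permanent_set_row0. Qed.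

Lemma card_ann_pred0 i : #|ann pred0 i| = (q ^ n)%N.
Proof.
rewrite -[n in (q ^ n)%N]mul1n -card_mx -cardsT; apply: eq_card => u.
by rewrite finset.in_setT; apply/annP.
Qed.

(** The map [(w, a) |-> a *: e + w] is injective from pairs in [W] and [F] into [W'], so a strict
    inclusion gains a factor [q] without any choice of basis. *)
Lemma card_subspace_lt (W W' : {set 'rV[F]_n}) e :
    0 \in W -> (forall a u v, u \in W -> v \in W -> a *: u + v \in W) ->
    (forall a u v, u \in W' -> v \in W' -> a *: u + v \in W') ->
    {subset W <= W'} -> e \notin W -> e \in W' ->
  (#|W| * q <= #|W'|)%N.
Proof.
move=> W0 Wlin W'lin WW' eW eW'.
pose f (x : 'rV[F]_n * F) := x.2 *: e + x.1.
rewrite -[q]cardsT -cardsX -(card_in_imset (f := f)).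
  apply/subset_leq_card/fintype.subsetP => _ /imsetP [[w a] /finset.setXP [wW _] ->].
  exact: W'lin (WW' _ wW).
move=> [w a] [w' a'] /finset.setXP [wW _] /finset.setXP [wW' _]; rewrite /f /= => E.
have E' : (a - a') *: e = (-1) *: w + w'.
  apply/eqP; rewrite scalerBl scaleN1r subr_eq -addrA [w' + _]addrC -E.
  by rewrite [_ + w]addrC addKr.
case: (a =P a') => [aa|/eqP aa].
  by move: E; rewrite aa => /addrI ->.
case/negP: eW; rewrite -(scalerK (a := a - a') _ e) ?subr_eq0 // -[_ *: _]addr0.
by rewrite E' Wlin ?Wlin.
Qed.

Lemma card_ann_lt P Q i j e : e \notin ann P i -> e \in ann Q j ->
  {subset ann P i <= ann Q j} -> (#|ann P i| * q <= #|ann Q j|)%N.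
Proof.
move=> eP eQ PQ; apply: (card_subspace_lt _ _ _ PQ eP eQ); first exact: ann0.
all: by move=> *; apply: ann_linear.
Qed.

Lemma card_kernel_le (f : 'rV[F]_n -> F) e : linear_for *%R f -> f e != 0 ->
  (#|[set u | f u == 0%R]%SET| * q <= q ^ n)%N.
Proof.
move=> flin fe; rewrite -[n in (_ <= _ ^ n)%N]mul1n -card_mx -[X in (_ <= X)%N]cardsT.
apply: (@card_subspace_lt _ _ e); rewrite ?inE //.
- by have := flin (-1) 0 0; rewrite scaler0 addr0 mulN1r addNr => ->.
- by move=> a u v; rewrite !inE flin => /eqP -> /eqP ->; rewrite mulr0 addr0.
- by move=> *; rewrite inE.
Qed.

(** When [f e != 0], a vector is recovered from its projection to the kernel along [e] together with
    the value [f u]. *)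
Lemma card_kernel_ge (f : 'rV[F]_n -> F) : linear_for *%R f ->
  (q ^ n <= #|[set u | f u == 0%R]%SET| * q)%N.
Proof.
move=> flin; rewrite -[n in (_ ^ n <= _)%N]mul1n -card_mx.
have [/existsP [e fe]|] := boolP [exists e, f e != 0]; last first.
  rewrite negb_exists => /forallP f0; rewrite -[X in (X <= _)%N]muln1.
  apply: leq_mul; last by apply/card_gt0P; exists 0.
  by apply: subset_leq_card; apply/fintype.subsetP => u _; rewrite inE; apply: negbNE.
pose g u : 'rV[F]_n * F := ((- (f u / f e)) *: e + u, f u).
rewrite -cardsT -[q]cardsT -cardsX -(card_in_imset (f := g)).
  apply/subset_leq_card/fintype.subsetP => _ /imsetP [u _ ->].
  by rewrite !inE flin mulNr divfK // addNr eqxx.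
by move=> u v _ _ [+ fuv]; rewrite fuv => /addrI.
Qed.

Definition agree S A : pred 'M[F]_n := [pred B | [forall i in S, row i B == row i A]].

Lemma agreeP S A B :
  reflect (forall i, i \in S -> row i B = row i A) (agree S A B).
Proof.
apply: (iffP forallP) => [H i iS|H i]; first by apply/eqP; move: (H i); rewrite iS.
by apply/implyP => iS; rewrite H.
Qed.

Lemma agree_set_row S A B i u :
  i \notin S -> agree S A (set_row B i u) = agree S A B.
Proof.
move=> iS; apply/agreeP/agreeP => H j jS; have ji : j != i by apply: contraNneq iS => <-.
  by rewrite -H // row_set_row_neq.
by rewrite row_set_row_neq ?H.
Qed.

Lemma agreeU1 S A B i u : i \notin S ->
  agree (i |: S) (set_row A i u) B = (row i B == u) && agree S A B.
Proof.
move=> iS; apply/agreeP/andP => [H|[/eqP Hi /agreeP H] j /finset.setU1P [->|jS]].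
- split; first by rewrite H ?finset.setU11 // row_set_row_eq.
  apply/agreeP => j jS; rewrite H ?finset.setU1r // row_set_row_neq //.
  by apply: contraNneq iS => <-.
- by rewrite row_set_row_eq.
- by rewrite H // row_set_row_neq //; apply: contraNneq iS => <-.
Qed.

Definition extendable S A : bool := [exists B, agree S A B && (permanent B != 0)].

(** This turns drawing a good next row into avoiding a subspace, so that probabilities reduce to
    bounds on [#|ann (agree S A) i|]. *)
Lemma extendable_set_row S A i u : i \notin S ->
  extendable (i |: S) (set_row A i u) = (u \notin ann (agree S A) i).
Proof.
move=> iS; apply/existsP/idP => [[B /andP []]|].
  rewrite agreeU1 // => /andP [/eqP <- AB] perB; apply/annP => /(_ B AB).
  by rewrite set_row_id; apply/eqP.
rewrite inE negb_forall => /existsP [B]; rewrite negb_imply => /andP [AB perB].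
by exists (set_row B i u); rewrite agreeU1 // row_set_row_eq eqxx agree_set_row ?AB.
Qed.

(* Let f be the product of the [#|S|] given forms.  Since f <> 0, f x_j <> 0 for
   some j; as x_j^2 = 0, the annihilator of f x_j contains x_j as well as that of
   f, which does not contain x_j. *)
Lemma card_ann_agree S A i :
  extendable S A -> i \notin S -> (#|ann (agree S A) i| <= q ^ #|S|)%N.
Proof.
have [k] := ubnP (n - #|S|); elim: k => // k IHk in S A i *.
move=> kS extS iS.
have /existsP [B /andP [AB perB]] := extS.
have [j perj] := permanent_set_row_unit i perB.
set e := unit_row F j in perj.
have eS : e \notin ann (agree S A) i by apply/annP => /(_ B AB); apply/eqP.
have cardS' : #|i |: S| = #|S|.+1 by rewrite cardsU1 iS.
have leS' : (#|i |: S| <= n)%N by rewrite -[n in (_ <= n)%N]card_ord max_card.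
have q0 : (0 < q)%N by apply/card_gt0P; exists 0.
rewrite -(leq_pmul2r q0) -expnSr -cardS'.
(* When [i] is the last free row, no row remains at which to take the larger annihilator; the whole
   space, as [ann pred0], replaces it. *)
have [/eqP S'T|] := eqVneq (i |: S) [set: 'I_n]%SET.
  apply: (leq_trans (card_ann_lt (Q := pred0) (j := i) eS _ _)).
  - by apply/annP.
  - by move=> u _; apply/annP.
  - by rewrite card_ann_pred0 (eqP S'T) cardsT card_ord.
rewrite -finset.subTset => /fintype.subsetPn [i' _ iS'].
have extS' : extendable (i |: S) (set_row A i e) by rewrite extendable_set_row.
apply: leq_trans (IHk _ _ _ _ extS' iS'); last by rewrite cardS' in leS' *; lia.
have ii' : i' != i by apply: contraNneq iS' => ->; rewrite finset.setU11.
apply: (card_ann_lt eS); first apply/annP => C; last move=> u /annP Hu; try apply/annP => C;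
  rewrite agreeU1 // => /andP [/eqP Ci CA].
- apply: (@permanent_unit_rows _ _ _ i' i j) => //; first by rewrite row_set_row_eq.
  by rewrite row_set_row_neq // eq_sym.
(* Exchanging rows [i] and [i'] puts [u] in row [i] and [e] in row [i']; the latter row is free in
   [agree S A], so [Hu] applies. *)
- rewrite -(set_row_id C i) Ci permanent_set_row_swap 1?eq_sym // set_rowC 1?eq_sym //.
  apply: Hu; rewrite agree_set_row //; apply: contra iS' => ?; exact: finset.setU1r.
Qed.

(* The [u] killing all completions lies in the kernel of the symmetric form
   [per (set_row (set_row A i1 _) i2 _)], which has rank at least 3 because its
   Gram matrix on the three unit vectors has determinant 2 G_ab G_ac G_bc. *)
Lemma card_ann_triangle S A i1 i2 a b c (G := fun x y =>
    permanent (set_row (set_row A i1 (unit_row F x)) i2 (unit_row F y))) :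
  2%:R != 0 :> F -> i1 \notin S -> i2 \notin S -> i1 != i2 ->
  G a b != 0 -> G a c != 0 -> G b c != 0 ->
  (#|ann (agree S A) i2| * q ^ 3 <= q ^ n)%N.
Proof.
move=> two0 i1S i2S i12 Gab Gac Gbc.
have GC x y : G x y = G y x by rewrite /G permanent_set_row_swap.
have G0 x : G x x = 0.
  apply: (@permanent_unit_rows _ _ _ i1 i2 x) => //; last by rewrite row_set_row_eq.
  by rewrite row_set_row_neq // row_set_row_eq.
pose M x := set_row A i1 (unit_row F x).
(* The three linear conditions [G x u = 0] for [x = a, b, c] are imposed one at a time;
   [unit_row b], [unit_row a] and then [v] witness that each one cuts the space strictly. *)
pose K (s : seq 'I_n) := ann (mem (map M s)) i2.
have KP s u : reflect (forall x, x \in s -> permanent (set_row (M x) i2 u) = 0) (u \in K s).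
  apply: (iffP (annP _ _ _)) => [H x xs|H B /mapP [x xs ->]]; last exact: H.
  by apply: H; apply: map_f.
have sub s x : {subset K (x :: s) <= K s}.
  by move=> u /KP H; apply/KP => y ys; apply: H; rewrite inE ys orbT.
have K0 : (#|K [::]| <= q ^ n)%N.
  by rewrite -[n in (_ <= _ ^ n)%N]mul1n -card_mx max_card.
have K1 : (#|K [:: a]| * q <= #|K [::]|)%N.
  apply: (@card_ann_lt _ _ _ _ (unit_row F b)); last exact: sub.
    by apply/KP => /(_ a (mem_head _ _)); apply/eqP.
  exact/KP.
have K2 : (#|K [:: b; a]| * q <= #|K [:: a]|)%N.
  apply: (@card_ann_lt _ _ _ _ (unit_row F a)); last exact: sub.
    by apply/KP => /(_ b (mem_head _ _)); apply/eqP; rewrite -/(G b a) GC.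
  by apply/KP => x; rewrite inE => /eqP ->; rewrite -/(G a a) G0.
(* The coefficients make the conditions at [a] and [b] cancel, while the value at [c] is
   [2 G_ac G_bc]; odd characteristic enters here. *)
pose v := G b c *: unit_row F a + (G a c *: unit_row F b + (- G a b) *: unit_row F c).
have Gv x : permanent (set_row (M x) i2 v) = G b c * G x a + (G a c * G x b - G a b * G x c).
  by rewrite /v !permanent_set_rowD !permanent_set_rowZ -!/(G _ _) mulNr.
have K3 : (#|K [:: c; b; a]| * q <= #|K [:: b; a]|)%N.
  apply: (@card_ann_lt _ _ _ _ v); last exact: sub.
    apply/KP => /(_ c (mem_head _ _)); apply/eqP.
    rewrite Gv (GC c a) (GC c b) G0 mulr0 subr0 (mulrC (G a c)) -mulr2n -mulr_natl.
    by rewrite !mulf_neq0.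
  apply/KP => x; rewrite !inE => /orP [] /eqP ->; rewrite Gv G0.
    by rewrite (GC b a) mulr0 add0r mulrC subrr.
  by rewrite mulr0 add0r mulrC subrr.
have KS : (#|ann (agree S A) i2| <= #|K [:: c; b; a]|)%N.
  apply/subset_leq_card/fintype.subsetP => u /annP H; apply/KP => x _; apply: H.
  by rewrite agree_set_row //; apply/agreeP.
nia.
Qed.

End Annihilator.

(** * Dependence of the entries [G_ab] on single columns *)

Section ColumnResampling.
Variables (F : finFieldType) (n : nat).
Implicit Types (A : 'M[F]_n) (i j a b c : 'I_n) (u v : 'rV[F]_n).

Definition set_col A j v : 'M[F]_n := (set_row A^T j v)^T.

Lemma set_colE A j v a b : set_col A j v a b = if b == j then v 0 a else A a b.
Proof. by rewrite !mxE. Qed.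

(** The entry [G_ab] of the overview, as a function of a full matrix whose rows [i1] and [i2] are
    overwritten, so that columns can be resampled uniformly. *)
Definition per2 i1 i2 a b A : F :=
  permanent (set_row (set_row A i1 (unit_row F a)) i2 (unit_row F b)).

Lemma per2C i1 i2 a b A : i1 != i2 -> per2 i1 i2 a b A = per2 i1 i2 b a A.
Proof. by move=> i12; rewrite /per2 permanent_set_row_swap. Qed.

Lemma permanent_eq_minor i b (A B : 'M[F]_n) :
    row i A = unit_row F b -> row i B = unit_row F b ->
    (forall k l, k != i -> l != b -> A k l = B k l) ->
  permanent A = permanent B.
Proof.
move=> /rowP rA /rowP rB AB; apply: eq_bigr => s _; rewrite !(bigD1 i (_ : predT i)) //=.
have := rA (s i); have := rB (s i); rewrite !mxE /= => -> ->.
case: (s i =P b) => [sb|_]; last by rewrite !mul0r.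
congr (_ * _); apply: eq_bigr => k ki; apply: AB => //.
by rewrite -sb (inj_eq perm_inj).
Qed.

Section TwoRows.
Variables (i1 i2 : 'I_n) (i12 : i1 != i2).
Local Notation G := (per2 i1 i2).

Lemma per2_set_colr a b v A : G a b (set_col A b v) = G a b A.
Proof.
apply: (@permanent_eq_minor i2 b); rewrite ?row_set_row_eq // => k l /negbTE ki /negbTE lb.
by rewrite !set_rowE set_colE ki lb.
Qed.

Lemma per2_set_coll a b v A : G a b (set_col A a v) = G a b A.
Proof. by rewrite !(per2C a) // per2_set_colr. Qed.

Lemma per2_set_col_linear a b c A : a != b -> c != b ->
  linear_for *%R (fun v => G a c (set_col A b v)).
Proof.
move=> ab cb.
(* In rows [i1] and [i2] column [b] holds entries of the unit rows at [a] and [c], which are 0 as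
   both differ from [b]. *)
pose r v : 'rV[F]_n := \row_k if (k == i1) || (k == i2) then 0 else v 0 k.
have E v : G a c (set_col A b v) =
    permanent (set_row (set_row (set_row A i1 (unit_row F a)) i2 (unit_row F c))^T b (r v)).
  rewrite -[RHS]permanent_tr; congr permanent; apply/matrixP => k l; rewrite !mxE.
  case: (l =P b) => [->|_] //; rewrite (eq_sym b) (negbTE cb) (eq_sym b) (negbTE ab) /=.
  by case: (k == i2); case: (k == i1); rewrite //= ?orbT.
move=> x u v; rewrite !E -permanent_set_row_is_linear; congr (permanent (set_row _ _ _)).
by apply/rowP => k; rewrite !mxE; case: ifP => //; rewrite mulr0 addr0.
Qed.

(** [G a b] ignores column [b], so column [c] may be copied there; exchanging the two columns then
    only moves the unit row from [b] to [c]. This provides a column at which the linear form [G a c]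
    is nonzero. *)
Lemma per2_set_col_swap a b c A : a != b -> a != c ->
  G a c (set_col A b (row c A^T)) = G a b A.
Proof.
move=> ab ac; rewrite -(per2_set_colr a b (row c A^T) A).
rewrite /per2 -(permanent_col_perm (tperm b c)); congr permanent.
apply/matrixP => k l; rewrite !mxE.
have tc : (tperm b c l == c) = (l == b).
  by rewrite -[X in _ == X](tpermL b c) (inj_eq perm_inj).
have ta : (tperm b c l == a) = (l == a).
  by rewrite -[X in _ == X](@tpermD _ b c a) 1?eq_sym // (inj_eq perm_inj).
case: (k =P i2) => _; first by rewrite tc.
case: (k =P i1) => _; first by rewrite ta.
case: tpermP => [->|->|/eqP/negbTE -> _] //; last by rewrite eqxx if_same.
by rewrite eqxx if_same.
Qed.

End TwoRows.
End ColumnResampling.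

(** * Uniform probability and resampling of one coordinate *)

Section Probability.
Variable R : realType.

Lemma unif_probE (T : finType) (E : pred T) :
  unif_prob R E = (\sum_t (E t)%:R) / #|T|%:R.
Proof.
rewrite /unif_prob -sum1_card natr_sum big_mkcond; congr (_ / _).
by apply: eq_bigr => t _; rewrite inE; case: (E t).
Qed.

Lemma unif_prob_subset (T : finType) (E E' : pred T) :
  (forall t, E t -> E' t) -> unif_prob R E <= unif_prob R E'.
Proof.
move=> EE'; rewrite !unif_probE ler_wpM2r ?invr_ge0 ?ler0n //.
by apply: ler_sum => t _; rewrite ler_nat; move: (EE' t); case: (E t) => // ->.
Qed.

Lemma unif_prob_true (T : finType) (t0 : T) (E : pred T) :
  (forall t, E t) -> unif_prob R E = 1.
Proof.
move=> ET; rewrite /unif_prob (eq_card (B := T)) => [|t]; last by rewrite inE ET.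
by rewrite divff // pnatr_eq0 -lt0n; apply/card_gt0P; exists t0.
Qed.

Lemma unif_probC (T : finType) (t0 : T) (E : pred T) :
  unif_prob R E = 1 - unif_prob R [pred t | ~~ E t].
Proof.
apply/eqP; rewrite eq_sym subr_eq -(unif_prob_true t0 (E := predT)) // !unif_probE.
rewrite -mulrDl -big_split /=; apply/eqP; congr (_ / _); apply: eq_bigr => t _.
by case: (E t); rewrite /= ?addr0 ?add0r.
Qed.

(** The map [(t, l) |-> (upd t l, get t)] is an involution, so resampling preserves the uniform law.
    Two weighted events are allowed in order to add a gain to a base bound. *)
Lemma unif_prob_resample (T L : finType) (upd : T -> L -> T) (get : T -> L)
    (E E1 E2 : pred T) (c d : R) :
    (forall t l, get (upd t l) = l) -> (forall t l, upd (upd t l) (get t) = t) ->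
    (forall t, c * (E1 t)%:R + d * (E2 t)%:R <= unif_prob R (fun l => E (upd t l))) ->
  c * unif_prob R E1 + d * unif_prob R E2 <= unif_prob R E.
Proof.
move=> getK updK H; rewrite !unif_probE !mulrA -mulrDl ler_wpM2r ?invr_ge0 ?ler0n //.
rewrite !mulr_sumr -big_split /=; apply: le_trans (ler_sum _ (fun t _ => H t)) _.
rewrite (eq_bigr _ (fun t _ => unif_probE (fun l => E (upd t l)))).
rewrite -mulr_suml pair_bigA /=.
have inv : involutive (fun x : T * L => (upd x.1 x.2, get x.1)).
  by move=> [t l] /=; rewrite getK updK.
rewrite (reindex_inj (inv_inj inv)) /=.
rewrite (eq_bigr (fun x : T * L => (E x.1)%:R)) => [|[t l] _]; last by rewrite /= updK.
rewrite -(pair_bigA _ (fun t l => (E t)%:R)) /=.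
(* For empty [L] the left side is 0, since the inverse of 0 is 0. *)
have [L0|L0] := eqVneq (#|L|%:R : R) 0.
  by rewrite L0 invr0 mulr0; apply: sumr_ge0 => t _; rewrite ler0n.
rewrite mulr_suml; apply: ler_sum => t _; rewrite sumr_const -[X in X / _]mulr_natr.
by rewrite mulfK.
Qed.

Lemma unif_prob_eq (T : finType) (E E' : pred T) :
  E =1 E' -> unif_prob R E = unif_prob R E'.
Proof. by move=> EE'; rewrite /unif_prob (eq_card (B := [pred t | E' t])). Qed.

Lemma unif_prob_ge0 (T : finType) (E : pred T) : 0 <= unif_prob R E.
Proof. by rewrite /unif_prob divr_ge0 ?ler0n. Qed.

Lemma unif_prob_resample1 (T L : finType) (upd : T -> L -> T) (get : T -> L)
    (E E1 : pred T) (c : R) :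
    (forall t l, get (upd t l) = l) -> (forall t l, upd (upd t l) (get t) = t) ->
    (forall t, E1 t -> c <= unif_prob R (fun l => E (upd t l))) ->
  c * unif_prob R E1 <= unif_prob R E.
Proof.
move=> getK updK H; rewrite -[leLHS]addr0 -[X in _ + X](mul0r (unif_prob R E1)).
apply: (unif_prob_resample getK updK) => t; rewrite mul0r addr0.
by have [/H|_] := boolP (E1 t); rewrite ?mulr1 // mulr0 unif_prob_ge0.
Qed.

End Probability.

(** * Bounds for vanishing and nonvanishing at fixed [n] *)

Section NonvanishingProbability.
Variables (R : realType) (F : finFieldType).
Local Notation q := #|F|.
Local Notation x := ((q%:R : R)^-1).
Local Notation euler a b := (\prod_(a <= i < b) (1 - x ^+ i)).

Lemma card_field_gt1 : (1 < q)%N.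
Proof. exact: card_finNzRing_gt1. Qed.

Lemma invq_gt0 : 0 < x.
Proof. by rewrite invr_gt0 ltr0n (ltn_trans _ card_field_gt1). Qed.

Lemma invq_lt1 : x < 1.
Proof. by rewrite invf_lt1 ?ltr1n ?ltr0n ?card_field_gt1 // (ltn_trans _ card_field_gt1). Qed.

Lemma unif_prob_notin_ge n (W : {set 'rV[F]_n}) m :
  (#|W| * q ^ m <= q ^ n)%N -> 1 - x ^+ m <= unif_prob R [pred u | u \notin W].
Proof.
move=> Wm; rewrite (unif_probC _ 0) lerD2l lerN2 /unif_prob card_mx mul1n.
have q0 : 0 < (q%:R : R) by rewrite -invr_gt0 invq_gt0.
rewrite natrX exprVn ler_pdivrMr ?exprn_gt0 // mulrC ler_pdivlMr ?exprn_gt0 //.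
rewrite -!natrX -natrM ler_nat; apply: leq_trans Wm; rewrite leq_mul2r; apply/orP; right.
by apply: subset_leq_card; apply/fintype.subsetP => u; rewrite !inE negbK.
Qed.

(** With the other rows fixed, the permanent is a linear form in row 0, whose kernel has codimension
    at most 1. *)
Lemma prob_per0_ge n : (0 < n)%N -> x <= prob_per0 R F n.
Proof.
case: n => // n _; rewrite /prob_per0.
rewrite -[leLHS]mulr1 -[X in _ * X](unif_prob_true R (0 : 'M[F]_n.+1) (E := predT)) //.
apply: (unif_prob_resample1 (upd := fun A u => set_row A 0 u) (get := fun A => row 0 A)).
- by move=> A u; rewrite row_set_row_eq.
- by move=> A u; rewrite set_row_set_row set_row_id.
move=> A _; rewrite /unif_prob card_mx mul1n.
have q0 : 0 < (q%:R : R) by rewrite -invr_gt0 invq_gt0.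
rewrite ler_pdivlMr ?ltr0n ?expn_gt0 ?(ltnW card_field_gt1) // mulrC ler_pdivrMr //.
rewrite -natrM ler_nat; apply: leq_trans (card_kernel_ge (permanent_set_row_is_linear A 0)) _.
rewrite leq_mul2r; apply/orP; right.
by apply: subset_leq_card; apply/fintype.subsetP => u; rewrite !inE.
Qed.

Definition override n (U : {set 'I_n}) (B A : 'M[F]_n) : 'M[F]_n :=
  \matrix_(i, j) if i \in U then B i j else A i j.

Lemma override_set_row n (U : {set 'I_n}) (B A : 'M[F]_n) i u : i \notin U ->
  override U B (set_row A i u) = set_row (override U B A) i u.
Proof.
move=> iU; apply/matrixP => k l; rewrite !mxE.
by case: (k =P i) => [->|//]; rewrite (negbTE iU).
Qed.

Lemma prob_extend_row n (S : {set 'I_n}) (A : 'M[F]_n) i m : i \notin S ->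
    (#|ann (agree S A) i| * q ^ m <= q ^ n)%N ->
  1 - x ^+ m <= unif_prob R (fun u => extendable (i |: S) (set_row A i u)).
Proof.
move=> iS /unif_prob_notin_ge; congr (_ <= _); apply: unif_prob_eq => u.
by rewrite extendable_set_row.
Qed.

Lemma card_ann_agree_exp n (S : {set 'I_n}) (A : 'M[F]_n) i :
    extendable S A -> i \notin S ->
  (#|ann (agree S A) i| * q ^ (n - #|S|) <= q ^ n)%N.
Proof.
move=> SA iS; rewrite -[n in (_ <= _ ^ n)%N](@subnKC #|S|) ?expnD.
  by rewrite leq_mul2r card_ann_agree ?orbT.
by rewrite -[n in (_ <= n)%N]card_ord max_card.
Qed.

Lemma euler_recl a b : (a < b)%N -> euler a b = (1 - x ^+ a) * euler a.+1 b.
Proof. exact: big_ltn. Qed.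

(** With [k] rows in place, the next must avoid a subspace of size at most [q^k], whence a factor
    [1 - x^(n-k)]. Prescribed rows [U] serve the bound on [per2], where two unit rows are fixed. *)
Lemma prob_extendable n (U S : {set 'I_n}) (B : 'M[F]_n) :
    (U \subset S)%SET -> extendable U B ->
  euler (n - #|S|).+1 (n - #|U|).+1 <=
  unif_prob R (fun A => extendable S (override U B A)).
Proof.
move=> US extB; have [k] := ubnP #|S|; elim: k => // k IHk in S US *.
move=> Sk; have [SU|] := boolP (S \subset U)%SET.
  have -> : S = U by apply/eqP; rewrite finset.eqEsubset SU.
  rewrite big_geq // (unif_prob_true _ 0) // => A.
  have /existsP [C /andP [/agreeP CB perC]] := extB; apply/existsP; exists C.
  rewrite perC andbT; apply/agreeP => i iU; rewrite CB //.
  by apply/rowP => j; rewrite !mxE iU.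
move=> /fintype.subsetPn [i iS iU].
have S'i : i \notin S :\ i by rewrite !inE eqxx.
have US' : (U \subset S :\ i)%SET by rewrite finset.subsetD1 US.
have cS : #|S| = #|S :\ i|.+1 by rewrite (cardsD1 i S) iS.
have cSn : (#|S| <= n)%N by rewrite -[n in (_ <= n)%N]card_ord max_card.
have cU : (#|U| <= #|S :\ i|)%N by exact: subset_leq_card.
have -> : (n - #|S|).+1 = (n - #|S :\ i|)%N by rewrite cS in cSn *; lia.
rewrite euler_recl; last by lia.
apply: le_trans (ler_wpM2l _ (IHk _ US' _)) _; [|by rewrite cS in Sk|].
  by rewrite subr_ge0 exprn_ile1 ?(ltW invq_lt1) ?(ltW invq_gt0).
apply: (unif_prob_resample1 (upd := fun A u => set_row A i u) (get := fun A => row i A)).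
- by move=> A u; rewrite row_set_row_eq.
- by move=> A u; rewrite set_row_set_row set_row_id.
move=> A ext; have := prob_extend_row S'i (card_ann_agree_exp ext S'i).
congr (_ <= _); apply: unif_prob_eq => u.
by rewrite finset.setD1K // override_set_row.
Qed.

(* (1 - x)^2 and not (1 - x)^3: given [per2 a b <> 0], resampling column [b] and
   then column [a] makes the two other values uniform. *)
Lemma prob_triangle n (i1 i2 a b c : 'I_n) :
    i1 != i2 -> a != b -> a != c -> b != c ->
  (1 - x) ^+ 2 * unif_prob R (fun A : 'M[F]_n => per2 i1 i2 a b A != 0) <=
  unif_prob R (fun A : 'M[F]_n =>
    [&& per2 i1 i2 a b A != 0, per2 i1 i2 a c A != 0 & per2 i1 i2 b c A != 0]).
Proof.
move=> i12 ab ac bc; set G := per2 i1 i2.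
have x0 := ltW invq_gt0; have x1 := ltW invq_lt1.
(* [E] does not see column [t], while [G s r] is linear in it and takes the nonzero value [G s t]
   when column [r] is copied there. *)
have step (E : pred 'M[F]_n) s t r : s != t -> r != t -> s != r ->
    (forall A, E A -> G s t A != 0) -> (forall A v, E A -> E (set_col A t v)) ->
    (1 - x) * unif_prob R E <= unif_prob R (fun A => E A && (G s r A != 0)).
  move=> st rt sr Est Et.
  apply: (unif_prob_resample1 (upd := fun A v => set_col A t v) (get := fun A => row t A^T)).
  - by move=> A v; rewrite trmxK row_set_row_eq.
  - by move=> A v; rewrite /set_col trmxK set_row_set_row set_row_id trmxK.
  move=> A EA; rewrite -[x]expr1.
  have e : G s r (set_col A t (row r A^T)) != 0 by rewrite /G per2_set_col_swap // Est.
  have ker := card_kernel_le (per2_set_col_linear i1 i2 A st rt) e.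
  apply: le_trans (@unif_prob_notin_ge _ _ 1 ker) _.
  by apply: unif_prob_subset => v; rewrite !inE Et.
rewrite expr2 -mulrA.
have := step (fun A => G a b A != 0) a b c ab; rewrite eq_sym => /(_ bc ac).
move=> /(_ (fun _ => id)) H1.
apply: (@le_trans _ _ ((1 - x) * unif_prob R (fun A => (G a b A != 0) && (G a c A != 0)))).
  rewrite ler_wpM2l ?subr_ge0 // H1 // => A v.
  by rewrite /G per2_set_colr.
have := step (fun A => (G a b A != 0) && (G a c A != 0)) b a c.
rewrite eq_sym (eq_sym c) => /(_ ab ac bc) H2.
apply: le_trans (H2 _ _) _.
- by move=> A /andP [+ _]; rewrite /G per2C.
- by move=> A v; rewrite /G !per2_set_coll.
by apply: unif_prob_subset => A; rewrite andbA.
Qed.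

(** The gain is a product: [x^2 - x^3] from the last row but one, [(1 - x)^2 euler 1 n.-1] for the
    probability of a triangle, and [1 - x] from the last row. *)
Lemma prob_per_neq0_ge n : 2%:R != 0 :> F -> (3 <= n)%N ->
  euler 1 n.+1 + x ^+ 2 * (1 - x) ^+ 4 * euler 1 n.-1 <=
  unif_prob R (fun A : 'M[F]_n => permanent A != 0).
Proof.
move=> two0 n3.
have n2 : (2 <= n)%N := ltnW n3.
pose a := Ordinal (ltn_trans (isT : 0 < 2)%N n3).
pose b := Ordinal (ltn_trans (isT : 1 < 2)%N n3).
pose c := Ordinal n3.
have ab : a != b by []. have ac : a != c by []. have bc : b != c by [].
have x0 := invq_gt0; have x1 := invq_lt1.
pose T := ~: [set a; b]%SET.
have aT : a \notin T by rewrite !inE eqxx.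
have bT : b \notin T by rewrite !inE eqxx orbT.
have cT : #|T| = (n - 2)%N by rewrite cardsCs finset.setCK cards2 ab card_ord.
pose S := b |: T.
have aS : a \notin S by rewrite !inE eqxx.
have cS : #|S| = (n - 1)%N by rewrite cardsU1 bT cT; lia.
pose good (A : 'M[F]_n) :=
  [&& per2 a b a b A != 0, per2 a b a c A != 0 & per2 a b b c A != 0].
have ext0 : extendable finset.set0 (1%:M : 'M[F]_n).
  by apply/existsP; exists 1%:M; rewrite permanent1 oner_eq0 andbT; apply/agreeP.
(* Rows [a] and [b] of the identity are the unit rows at [a] and [b], so prescribing them yields
   [per2 a b a b]. *)
have ext2 : extendable [set a; b]%SET (1%:M : 'M[F]_n).
  by apply/existsP; exists 1%:M; rewrite permanent1 oner_eq0 andbT; apply/agreeP.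
have H1 : euler 3 n.+1 <= unif_prob R (fun A : 'M[F]_n => extendable T A).
  have := prob_extendable (finset.sub0set T) ext0.
  rewrite cT cards0 subn0 subKn // => /le_trans; apply; rewrite le_eqVlt.
  apply/orP; left; apply/eqP/unif_prob_eq => A; congr extendable.
  by apply/matrixP => i j; rewrite !mxE inE.
(* [good] implies that [T] is extendable, and on it the failure bound for row [b] improves from
   [x^2] to [x^3]. *)
have H2 : (1 - x ^+ 2) * unif_prob R (fun A : 'M[F]_n => extendable T A) +
      (x ^+ 2 - x ^+ 3) * unif_prob R good <=
    unif_prob R (fun A : 'M[F]_n => extendable S A).
  apply: (unif_prob_resample (upd := fun A u => set_row A b u) (get := fun A => row b A)).
  - by move=> A u; rewrite row_set_row_eq.
  - by move=> A u; rewrite set_row_set_row set_row_id.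
  move=> A; have [gA|_] := boolP (good A).
    have ext : extendable T A.
      apply/existsP; exists (set_row (set_row A a (unit_row F a)) b (unit_row F b)).
      case/and3P: gA => gA _ _; rewrite gA !agree_set_row // andbT; exact/agreeP.
    rewrite ext !mulr1 addrA subrK; apply: prob_extend_row => //.
    by case/and3P: gA => *; apply: (@card_ann_triangle _ _ T A a b a b c).
  rewrite mulr0 addr0.
  have [ext|_] := boolP (extendable _ _); last by rewrite mulr0 unif_prob_ge0.
  rewrite mulr1; have := prob_extend_row bT (card_ann_agree_exp ext bT).
  by rewrite cT subKn.
have H3 : (1 - x) * unif_prob R (fun A : 'M[F]_n => extendable S A) <=
    unif_prob R (fun A : 'M[F]_n => permanent A != 0).
  apply: (unif_prob_resample1 (upd := fun A u => set_row A a u) (get := fun A => row a A)).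
  - by move=> A u; rewrite row_set_row_eq.
  - by move=> A u; rewrite set_row_set_row set_row_id.
  move=> A ext; have := prob_extend_row aS (card_ann_agree_exp ext aS).
  rewrite cS subKn ?(ltn_trans _ n3) // expr1 => /le_trans; apply.
  apply: unif_prob_subset => u /existsP [C /andP [/agreeP CA]].
  suff -> : C = set_row A a u by [].
  apply/row_matrixP => i; apply: CA; rewrite !inE.
  by case: (i == a) => //; case: (i == b).
have H4 : (1 - x) ^+ 2 * euler 1 n.-1 <= unif_prob R good.
  apply: le_trans (prob_triangle ab ab ac bc); apply: ler_wpM2l; first by rewrite sqr_ge0.
  have := prob_extendable (finset.subsetT _) ext2.
  rewrite cardsT card_ord subnn cards2 ab.
  rewrite -subSn // subSS subn1.
  move=> /le_trans; apply; apply: unif_prob_subset => A /existsP [C /andP [/agreeP CA]].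
  suff -> : C = set_row (set_row A a (unit_row F a)) b (unit_row F b) by [].
  apply/row_matrixP => i; rewrite CA ?inE //; apply/rowP => j; rewrite !mxE !inE.
  by case: (i =P b) => [->|_]; rewrite ?orbT; [|case: (i =P a) => [->|_]]; rewrite //= eq_sym.
apply: le_trans H3.
rewrite (euler_recl (a := 1)) ?ltnS ?(ltnW n2) // (euler_recl (a := 2)) ?ltnS // expr1.
set e3 := euler 3 n.+1 in H1 *; set e1 := euler 1 n.-1 in H4 *.
have -> : (1 - x) * ((1 - x ^+ 2) * e3) + x ^+ 2 * (1 - x) ^+ 4 * e1 =
  (1 - x) * ((1 - x ^+ 2) * e3 + (x ^+ 2 - x ^+ 3) * ((1 - x) ^+ 2 * e1)) by ring.
apply: ler_wpM2l; first by rewrite subr_ge0 ltW.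
apply: le_trans H2.
apply: lerD; apply: ler_wpM2l => //.
  by rewrite subr_ge0 exprn_ile1 ?ltW.
by rewrite subr_ge0 ler_wiXn2l ?ltW.
Qed.

End NonvanishingProbability.

(** * Estimates and limits of the Euler products *)

Section EulerProduct.
Variables (R : realType) (x : R).
Local Notation euler a b := (\prod_(a <= i < b) (1 - x ^+ i)).

(** Induction from the left, by [(1 - x^a) (1 - 2 x^(a+1)) >= 1 - 2 x^a]. At [a = 1] it keeps the
    product at least [1/3]. *)
Lemma euler_ge (x_ge0 : 0 <= x) (x_le3 : 3 * x <= 1) a b : 1 - 2 * x ^+ a <= euler a b.
Proof.
have [k] := ubnP (b - a)%N; elim: k a => // k IHk a kab.
have xa : 0 <= x ^+ a by rewrite exprn_ge0.
have [ba|ab] := leqP b a; first by rewrite big_geq // gerBl mulr_ge0.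
rewrite big_ltn //; have xa1 : x ^+ a <= 1 by rewrite exprn_ile1 //; lra.
have /ler_wpM2l IH := IHk a.+1 ltac:(lia); apply: le_trans (IH _ _); last by rewrite subr_ge0.
rewrite exprS; nra.
Qed.

Lemma euler1_gt0 (x_ge0 : 0 <= x) (x_le3 : 3 * x <= 1) b : 1 <= 3 * euler 1 b.
Proof. by have := euler_ge x_ge0 x_le3 1 b; rewrite expr1; lra. Qed.

Lemma euler1_nonincreasing (x_ge0 : 0 <= x) (x_le3 : 3 * x <= 1) :
  nonincreasing_seq (fun n => euler 1 n.+1).
Proof.
apply/nonincreasing_seqP => n; rewrite [leLHS]big_nat_recr //= ler_piMr //.
  by have := euler1_gt0 x_ge0 x_le3 n.+1; lra.
by rewrite gerBl exprn_ge0.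
Qed.

Lemma euler1_is_cvgn (x_ge0 : 0 <= x) (x_le3 : 3 * x <= 1) : cvgn (fun n => euler 1 n.+1).
Proof.
apply: nonincreasing_is_cvgn; first exact: euler1_nonincreasing x_ge0 x_le3.
by exists 0 => _ [n _ <-]; have := euler1_gt0 x_ge0 x_le3 n.+1; lra.
Qed.

Lemma euler1_lim_le (x_ge0 : 0 <= x) (x_le3 : 3 * x <= 1) n :
  limn (fun n => euler 1 n.+1) <= euler 1 n.+1.
Proof.
apply: nonincreasing_cvgn_ge; first exact: euler1_nonincreasing.
exact: euler1_is_cvgn.
Qed.

Lemma euler1_lim_gt0 (x_ge0 : 0 <= x) (x_le3 : 3 * x <= 1) :
  0 < limn (fun n => euler 1 n.+1).
Proof.
have : 1 / 3 <= limn (fun n => euler 1 n.+1).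
  apply: limr_ge; first exact: euler1_is_cvgn x_ge0 x_le3.
  by apply: nearW => n; have := euler1_gt0 x_ge0 x_le3 n.+1; lra.
by apply: lt_le_trans; rewrite divr_gt0.
Qed.

(** The gain [x^2] cancels the term [-x^2] of [(1 - x) (1 - x^2)], leaving an error of third
    order. *)
Lemma euler_third_order_bound (x_ge0 : 0 <= x) (x_le3 : 3 * x <= 1) n : 
  1 - x - 7 * x ^+ 3 <= euler 1 n.+3 + x ^+ 2 * (1 - x) ^+ 4 * euler 1 n.+1.
Proof.
rewrite (big_ltn (m := 1)) // (big_ltn (m := 2)) // expr1.
set e3 := \prod_(3 <= i < _) _; set e1 := \prod_(1 <= i < _) _.
have He3 : 1 - 2 * x ^+ 3 <= e3 := euler_ge x_ge0 x_le3 3 n.+3.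
have He1 : 1 - 2 * x <= e1 by have := euler_ge x_ge0 x_le3 1 n.+1; rewrite expr1.
have H3 : (1 - x) * ((1 - x ^+ 2) * (1 - 2 * x ^+ 3)) <= (1 - x) * ((1 - x ^+ 2) * e3).
  by do 2!(apply: ler_wpM2l; first nra).
have H4 : 1 - 4 * x <= (1 - x) ^+ 4 by rewrite (exprM _ 2 2); nra.
have H1 : x ^+ 2 * ((1 - 4 * x) * (1 - 2 * x)) <= x ^+ 2 * ((1 - x) ^+ 4 * e1).
  apply: ler_wpM2l; first exact: sqr_ge0.
  apply: (@le_trans _ _ ((1 - x) ^+ 4 * (1 - 2 * x))).
    by apply: ler_wpM2r => //; lra.
  by apply: ler_wpM2l => //; rewrite exprn_even_ge0.
rewrite -(mulrA (x ^+ 2)); apply: le_trans (lerD H3 H1).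
have x3 : 0 <= x ^+ 3 by rewrite exprn_ge0.
have x4 : 0 <= x ^+ 4 by rewrite exprn_ge0.
have x6 : x ^+ 6 <= x ^+ 3.
  by rewrite ler_wiXn2l //; lra.
have x5 : 0 <= x ^+ 5 by rewrite exprn_ge0.
(* The coefficient of [x^3] is [1 - 2 - 6 = -7], and the remainder [10 x^4 + 2 x^5 - 2 x^6] is
   nonnegative. *)
rewrite -subr_ge0; nra.
Qed.

End EulerProduct.

(** * Upper limits and the conclusion *)

Lemma limn_sup_le (R : realType) (u : nat -> R) (l m : R) N :
    (forall n, m <= u n) -> has_ubound (range u) ->
    (forall n, (N <= n)%N -> u n <= l) ->
  limn_sup u <= l.
Proof.
move=> mu ub ul.
have lb : has_lbound (range u) by exists m => _ [n _ <-].
apply: limr_le; first by apply: cvgP; apply: cvg_sups_inf.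
exists N => // n /= Nn; apply: ge_sup; first by exists (u n); exists n => /=.
by move=> _ [p /= np <-]; apply: ul; apply: leq_trans np.
Qed.

Theorem theorem1p3 (R : realType) :
  exists C : R, 0 < C /\
    forall (F : finFieldType) (p : nat), p \in [pchar F] -> odd p ->
      [/\ forall n : nat, (0 < n)%N -> 1 / #|F|%:R <= prob_per0 R F n,
          limn_sup (fun n : nat => prob_per0 R F n) < alpha R #|F|
        & forall n : nat, (3 <= n)%N ->
            prob_per0 R F n <= 1 / #|F|%:R + C / #|F|%:R ^+ 3].
Proof.
exists 7; split => // F p pF podd.
have two0 : 2%:R != 0 :> F.
  rewrite -(dvdn_pcharf pF); apply/negP => /dvdn_leq => /(_ isT).
  by have := prime_gt1 (pcharf_prime pF); case: p podd {pF} => [|[|[|]]].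
(* The elements 0, 1, 2 are distinct; this gives [3 * x <= 1], as the Euler estimates require. *)
have q3 : (3 <= #|F|)%N.
  have u : uniq [:: 0; 1; 2%:R : F].
    rewrite /= !inE !negb_or eq_sym oner_eq0 eq_sym two0 andbT /=.
    by rewrite -subr_eq0 -opprB oppr_eq0 mulr2n addrK oner_eq0.
  by have := max_card (mem [:: 0; 1; 2%:R : F]); rewrite (card_uniqP u).
set x := (#|F|%:R : R)^-1.
have x_gt0 : 0 < x by apply: invq_gt0.
have x_ge0 := ltW x_gt0.
have x3 : 3 * x <= 1.
  by rewrite /x ler_pdivrMr ?mul1r ?ler_nat // ltr0n (leq_trans _ q3).
have perE n : prob_per0 R F n = 1 - unif_prob R (fun A : 'M[F]_n => permanent A != 0).
  by rewrite /prob_per0 (unif_probC R 0).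
split=> [n n0||n n3]; first by rewrite mul1r prob_per0_ge.
  have alphaE : alpha R #|F| = 1 - limn (fun n => \prod_(1 <= i < n.+1) (1 - x ^+ i)).
    rewrite /alpha; congr (_ - _); congr (limn _); apply/funext => n.
    by apply: eq_bigr => i _; rewrite exprVn.
  set L := limn _ in alphaE; have L0 : 0 < L := euler1_lim_gt0 x_ge0 x3.
  have d0 : 0 < x ^+ 2 * (1 - x) ^+ 4 * L.
    by rewrite !mulr_gt0 ?exprn_gt0 //; lra.
  (* Both Euler products decrease to [L], so replacing each by [L] gives one bound for all [n >= 3],
     strictly below [1 - L]. *)
  apply: (@le_lt_trans _ _ (1 - (L + x ^+ 2 * (1 - x) ^+ 4 * L))); last first.
    by rewrite alphaE; lra.
  apply: (@limn_sup_le _ _ _ 0 3) => [n||n n3].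
  - exact: unif_prob_ge0.
  - by exists 1 => _ [n _ <-]; rewrite perE gerBl unif_prob_ge0.
  rewrite perE lerD2l lerN2; apply: le_trans (prob_per_neq0_ge R two0 n3).
  apply: lerD; first exact: (euler1_lim_le x_ge0 x3).
  apply: ler_wpM2l; first by rewrite mulr_ge0 ?exprn_even_ge0.
  by case: n n3 => [|[|n]] // _; apply: (euler1_lim_le x_ge0 x3).
rewrite perE mul1r -exprVn.
have := prob_per_neq0_ge R two0 n3; case: n n3 => [|[|n]] // n3 H.
have := euler_third_order_bound x_ge0 x3 n; rewrite -/x in H *; lra.
Qed.
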